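(* Let $\mathcal{G}=(G,\mathcal{F}_0,\mathcal{F}_1)$ be a Muller game on an arena $G=(V,V_0,V_1,E)$, let $i\in\{0,1\}$, and let $W_i$ be the winning region of Player $i$. Then Player $i$ has a strategy $\sigma$ that is a winning strategy for $W_i$ and satisfies $\mathrm{MaxSc}_{\mathcal{F}_{1-i}}(\mathrm{Play}(v,\sigma,\tau))\le 2$ for every vertex $v\in W_i$ and every strategy $\tau$ of Player $1-i$.
   Context: An arena $G=(V,V_0,V_1,E)$ is a finite directed graph $(V,E)$ in which every vertex has at least one outgoing edge, with a partition $(V_0,V_1)$ of $V$ into the positions of Player $0$ and Player $1$. A play is an infinite path. A strategy for Player $i$ is a function $\sigma\colon V^*V_i\to V$ with $(s,\sigma(ws))\in E$ for all $ws\in V^*V_i$; a play $\rho_0\rho_1\cdots$ is consistent with $\sigma$ if $\rho_{m+1}=\sigma(\rho_0\cdots\rho_m)$ whenever $\rho_m\in V_i$. $\mathrm{Play}(v,\sigma,\tau)$ denotes the unique play starting in $v$ consistent with both strategies $\sigma$ and $\tau$. In a Muller game $(G,\mathcal{F}_0,\mathcal{F}_1)$, where $(\mathcal{F}_0,\mathcal{F}_1)$ is a partition of $2^V$, Player $i$ wins a play iff the set of vertices occurring infinitely often in it belongs to $\mathcal{F}_i$. A strategy is winning for a set $W$ if every play starting in a vertex of $W$ and consistent with it is won by its owner; the winning region $W_i$ is the set of vertices from which Player $i$ has a winning strategy. For a finite word $x$ over $V$, $\mathrm{Occ}(x)$ is the set of vertices occurring in $x$. For $F\subseteq V$ and $w\in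 V^+$, the score $\mathrm{Sc}_F(w)$ is the maximal $k\in\mathbb{N}$ such that there are $x_1,\dots,x_k\in V^+$ with $\mathrm{Occ}(x_j)=F$ for all $j$ and $x_1\cdots x_k$ a suffix of $w$. For $\mathcal{F}\subseteq 2^V$ and a finite or infinite word $\rho$, $\mathrm{MaxSc}_{\mathcal{F}}(\rho)=\max_{F\in\mathcal{F}}\max_{w\sqsubseteq\rho}\mathrm{Sc}_F(w)\in\mathbb{N}\cup\{\infty\}$, where $w$ ranges over finite non-empty prefixes of $\rho$ (and the value is $0$ if $\mathcal{F}=\emptyset$). *)

(* Defs.v *)
From mathcomp Require Import all_boot boolp.

Set Implicit Arguments.
Unset Strict Implicit.
Unset Printing Implicit Defensive.

(* Unlike [finset.partition], blocks may be empty. *)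
Definition bipartition (T : finType) (A B : {set T}) : Prop :=
  A :|: B = [set: T] /\ A :&: B = set0.

Record arena (V : finType) := Arena {
  pos0 : {set V};
  pos1 : {set V};
  edge : rel V;
  pos_bipartition : bipartition pos0 pos1;
  edge_total : forall v : V, exists w : V, edge v w }.

(* Players are booleans: [false] is Player 0, [true] is Player 1, and the
   opponent of [i] is [~~ i]. *)
Definition pos (V : finType) (G : arena V) (i : bool) : {set V} :=
  if i then pos1 G else pos0 G.

Definition is_play (V : finType) (G : arena V) (rho : nat -> V) : Prop :=
  forall n, edge G (rho n) (rho n.+1).

(* A nonempty history [ws] is passed as the two arguments [w] and [s]; the
   values at [s \notin pos G i] are junk and never used. *)
Record strategy (V : finType) (G : arena V) (i : bool) := Strategy {
  next_move :> seq V -> V -> V;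
  move_edge : forall w s, s \in pos G i -> edge G s (next_move w s) }.

Definition consistent (V : finType) (G : arena V) (i : bool)
    (sigma : strategy G i) (rho : nat -> V) : Prop :=
  forall m, rho m \in pos G i -> rho m.+1 = sigma (mkseq rho m) (rho m).

Section Play.
Variables (V : finType) (G : arena V) (i : bool).
Variables (v : V) (sigma : strategy G i) (tau : strategy G (~~ i)).

(* The pair (rho_0 ... rho_(n-1), rho_n). *)
Fixpoint play_state (n : nat) : seq V * V :=
  if n is m.+1 then
    let: (w, s) := play_state m in
    (rcons w s, if s \in pos G i then sigma w s else tau w s)
  else ([::], v).

Definition play (n : nat) : V := (play_state n).2.

Lemma in_posN s : (s \in pos G (~~ i)) = (s \notin pos G i).
Proof.
have [U I] := pos_bipartition G.
have : s \in pos0 G :|: pos1 G by rewrite U inE.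
have : s \notin pos0 G :&: pos1 G by rewrite I inE.
by rewrite !inE /pos; case: i => /=; case: (s \in pos0 G); case: (s \in pos1 G).
Qed.

Lemma play_stateE n : play_state n = (mkseq play n, play n).
Proof.
elim: n => [//|n IHn]; rewrite {2}/play /=.
by rewrite IHn /= /mkseq -addn1 iotaD map_cat cats1.
Qed.

Lemma playS n : play n.+1 =
  if play n \in pos G i then sigma (mkseq play n) (play n)
  else tau (mkseq play n) (play n).
Proof. by rewrite {1}/play /= play_stateE. Qed.

Lemma play_spec :
  [/\ is_play G play, play 0 = v, consistent sigma play & consistent tau play].
Proof.
split=> // n.
- rewrite playS; case: ifPn => Hn; apply: move_edge => //.
  by rewrite in_posN.
- by move=> Hn; rewrite playS Hn.
- by rewrite in_posN => /negPf Hn; rewrite playS Hn.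
Qed.

Lemma play_uniq rho : rho 0 = v -> consistent sigma rho ->
  consistent tau rho -> rho =1 play.
Proof.
move=> rho0 Hs Ht n; suff [] : mkseq rho n = mkseq play n /\ rho n = play n by [].
elim: n => [|n [IHw IHs]]; first by split.
split; first by move: IHw; rewrite /mkseq -addn1 iotaD !map_cat => ->; rewrite /= IHs.
rewrite playS -IHw -IHs; case: ifPn => Hn; first exact: Hs.
by apply: Ht; rewrite in_posN.
Qed.

End Play.

Record muller_game (V : finType) := MullerGame {
  game_arena :> arena V;
  family0 : {set {set V}};
  family1 : {set {set V}};
  family_bipartition : bipartition family0 family1 }.

Definition muller_family (V : finType) (G : muller_game V) (i : bool) :
    {set {set V}} :=
  if i then family1 G else family0 G.

Definition inf_set (V : finType) (rho : nat -> V) : {set V} :=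
  [set v | `[< forall n, exists2 m, n <= m & rho m = v >]].

Definition wins (V : finType) (G : muller_game V) (i : bool)
    (rho : nat -> V) : Prop :=
  inf_set rho \in muller_family G i.

Definition winning (V : finType) (G : muller_game V) (i : bool)
    (sigma : strategy G i) (W : {set V}) : Prop :=
  forall rho, is_play G rho -> rho 0 \in W -> consistent sigma rho ->
    wins G i rho.

Definition win_region (V : finType) (G : muller_game V) (i : bool) : {set V} :=
  [set v | `[< exists sigma : strategy G i, winning sigma [set v] >]].

Definition occ (V : finType) (x : seq V) : {set V} := [set v in x].

Definition score_witness (V : finType) (F : {set V}) (w : seq V) (k : nat) :
    Prop :=
  exists xs : seq (seq V),
    [/\ size xs = k,
        forall x, x \in xs -> x <> [::] /\ occ x = F
      & suffix (flatten xs) w].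

(* The bound [k <= size w] loses nothing, the factors being nonempty
   (see [score_max]). *)
Definition score (V : finType) (F : {set V}) (w : seq V) : nat :=
  \max_(k < (size w).+1 | `[< score_witness F w k >]) k.

Lemma score_witness_size (V : finType) (F : {set V}) (w : seq V) k :
  score_witness F w k -> k <= size w.
Proof.
move=> [xs [<- Hxs /size_suffix]]; apply: leq_trans.
elim: xs Hxs => [//|x xs IH] Hxs /=; rewrite size_cat -add1n leq_add //.
  by have [] := Hxs x (mem_head _ _); case: x {Hxs}.
by apply: IH => y Hy; apply: Hxs; rewrite inE Hy orbT.
Qed.

Lemma score_max (V : finType) (F : {set V}) (w : seq V) k :
  score_witness F w k -> k <= score F w.
Proof.
move=> Hk; have lt_k : k < (size w).+1 by rewrite ltnS (score_witness_size Hk).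
by apply: (bigmax_sup (Ordinal lt_k)) => //; apply/asboolP.
Qed.

Lemma scoreP (V : finType) (F : {set V}) (w : seq V) :
  score_witness F w (score F w).
Proof.
rewrite /score; elim/big_ind: _ => [|a b Ha Hb|k /asboolP //].
  by exists [::]; split=> //; apply: suffix0s.
by rewrite /maxn; case: ifP.
Qed.

Definition score_ub (V : finType) (Fs : {set {set V}}) (rho : nat -> V)
    (b : nat) : Prop :=
  forall F, F \in Fs -> forall n, score F (mkseq rho n.+1) <= b.

(* Values in N extended with infinity: [Some k] is [k], [None] is infinity. *)
Definition enat := option nat.

Definition le_enat (x y : enat) : bool :=
  match x, y with
  | Some k, Some l => k <= l
  | _, None => true
  | None, Some _ => false
  end.

(* The least upper bound in the extended naturals, i.e. the maximum, of the
   scores of the sets in [Fs] over the nonempty finite prefixes of [rho];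
   it is 0 if [Fs] is empty. *)
Definition maxsc (V : finType) (Fs : {set {set V}}) (rho : nat -> V) : enat :=
  if pselect (exists b, `[< score_ub Fs rho b >]) is left ubs
  then Some (ex_minn ubs) else None.

Lemma maxsc_le (V : finType) (Fs : {set {set V}}) (rho : nat -> V) b :
  le_enat (maxsc Fs rho) (Some b) <-> score_ub Fs rho b.
Proof.
rewrite /maxsc; case: pselect => [ubs|no_ub] /=.
  case: ex_minnP => m /asboolP Hm min_m; split=> [le_mb F HF n|Hb].
    exact: leq_trans (Hm F HF n) le_mb.
  by apply: min_m; apply/asboolP.
by split=> // Hb; case: no_ub; exists b; apply/asboolP.
Qed.

Lemma maxsc0 (V : finType) (rho : nat -> V) : maxsc set0 rho = Some 0.
Proof.
have : le_enat (maxsc set0 rho) (Some 0).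
  by apply/maxsc_le => F; rewrite inE.
by case: maxsc => [[]|].
Qed.

(* Main.v *)
(* Write i for the player whose opponent's scores are to be bounded. If the
   vertices visited infinitely often formed an opponent set, the score of that
   set would be unbounded, so bounding the scores by 2 already wins the play:
   everything reduces to the safety objective "no opponent set gets score 3".
   As in Zielonka's algorithm, each subarena X is covered by two regions, one
   per player, in which that player can keep the scores of the opponent sets
   contained in the region at most 2; this is shown by induction on |X|. To make
   the induction go through, play may start from any history that is fresh:
   every opponent set has score at most 1 there and has accumulated nothing
   since it reached score 1.
   Let X be in the family of i. If the opponent has a nonempty region B in the
   complement Y_C of i's attractor to X \ C, for some opponent set C in X, then
   the opponent attracts to B, and the rest of X is smaller. Otherwise i is safe
   in all Y_C and hence in X: from a fresh history h, i picks an opponent set C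
   containing the longest suffix of h that fits in any opponent set, plays safely
   while in Y_C, and otherwise attracts to X \ C. When a vertex outside C is
   reached the history is fresh again: for an opponent set F to have score 1 and
   a further visit, the last vertex v must have occurred before inside the
   current run of F, hence in h, and so in a suffix of h contained in F; but such
   suffixes lie in C, while v does not. *)

Require Import Defs.
From mathcomp Require Import all_boot.
From mathcomp Require Import boolp.

Set Implicit Arguments.
Unset Strict Implicit.
Unset Printing Implicit Defensive.

(** * Scores of words *)

Section Words.
Variable V : finType.
Implicit Types (F : {set V}) (h t u w : seq V).

Lemma cat_eq_cat (T : Type) (a b c d : seq T) : a ++ b = c ++ d ->
  (exists e, a = c ++ e /\ d = e ++ b) \/ (exists e, c = a ++ e /\ b = e ++ d).
Proof.
elim: a c => [|x a IH] [|y c] /=.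
- by move=> ->; left; exists [::].
- by move=> ->; right; exists (y :: c).
- by move=> <-; left; exists (x :: a).
- by case=> -> /IH [[e [-> ->]]|[e [-> ->]]]; [left|right]; exists e.
Qed.

Lemma subset_occ F x : (F \subset occ x) <-> {subset F <= x}.
Proof. by split=> [/subsetP H v /H|H]; [|apply/subsetP => v /H]; rewrite inE. Qed.

Lemma score_le2 F w :
  (forall p x1 x2 x3, w = p ++ x1 ++ x2 ++ x3 ->
    [/\ x1 != [::], x2 != [::] & x3 != [::]] ->
    [/\ occ x1 = F, occ x2 = F & occ x3 = F] -> False) ->
  score F w <= 2.
Proof.
move=> H; rewrite leqNgt; apply/negP => gt2.
have [xs [szxs Hxs /suffixP [p wE]]] := scoreP F w.
case/lastP: xs => [|xs x3] in szxs Hxs wE *; first by rewrite -szxs in gt2.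
case/lastP: xs => [|xs x2] in szxs Hxs wE *; first by rewrite -szxs in gt2.
case/lastP: xs => [|xs x1] in szxs Hxs wE *; first by rewrite -szxs in gt2.
have in_xs y : y \in [:: x1; x2; x3] -> y <> [::] /\ occ y = F.
  move=> Hy; apply: Hxs; move: Hy; rewrite -!cats1 !mem_cat !inE.
  by case/or3P => ->; rewrite ?orbT.
have [n1 o1] := in_xs x1 (mem_head _ _).
have [n2 o2] : x2 <> [::] /\ occ x2 = F by apply: in_xs; rewrite !inE eqxx orbT.
have [n3 o3] : x3 <> [::] /\ occ x3 = F by apply: in_xs; rewrite !inE eqxx !orbT.
apply: (H (p ++ flatten xs) x1 x2 x3) => //; last by split; apply/eqP.
by rewrite wE !flatten_rcons -!catA.
Qed.

(* [F] has score at most 1 after [h], and if it has score 1 then it has just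
   reached it. *)
Definition fresh F h :=
  forall p x q, h = p ++ x ++ q -> occ x = F -> {subset q <= F} -> q = [::].

(** A nonempty run inside [F] after a completed factor would end in [v], and the letter before [v]
    would have to lie in [F] as well. *)
Lemma fresh_rcons F w v :
  (forall w' s, w = rcons w' s -> s \notin F) -> fresh F (rcons w v).
Proof.
move=> HF p x q + occx; case/lastP: q => [//|q v'].
rewrite catA -rcons_cat => /rcons_inj [wE <-] sub_q.
have vF : v \in F by apply: sub_q; rewrite mem_rcons mem_head.
move: wE sub_q; case/lastP: q => [|q s] wE sub_q.
  case/lastP: x => [|x s] in occx wE; first by rewrite -occx inE in vF.
  have : s \notin F by apply: (HF (p ++ x)); rewrite wE cats0 rcons_cat.
  by rewrite -occx inE mem_rcons mem_head.
have : s \notin F by apply: (HF ((p ++ x) ++ q)); rewrite wE rcons_cat.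
by rewrite sub_q // mem_rcons inE mem_rcons mem_head orbT.
Qed.

Lemma fresh_cat_rcons F h u v :
  (forall p q, h = p ++ q -> {subset q <= F} -> v \notin q) -> v \notin u ->
  fresh F (rcons (h ++ u) v).
Proof.
move=> notin_h notin_u p x q + occx; case/lastP: q => [//|q v'].
rewrite catA -rcons_cat => /rcons_inj [wE <-] sub_q.
have vx : v \in x.
  have : v \in F by apply: sub_q; rewrite mem_rcons mem_head.
  by rewrite -occx inE.
move: wE; rewrite -catA => /cat_eq_cat [[e [hE xqE]]|[e [_ uE]]]; last first.
  by move: notin_u; rewrite uE !mem_cat vx orbT.
have : v \in e ++ u by rewrite -xqE mem_cat vx.
rewrite mem_cat (negPf notin_u) orbF => ve.
suff : v \notin e by rewrite ve.
apply: (notin_h p) => // y ye.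
have : y \in x ++ q by rewrite xqE mem_cat ye.
rewrite mem_cat => /orP[|yq]; first by rewrite -occx inE.
by apply: sub_q; rewrite mem_rcons inE yq orbT.
Qed.

(** Since [u] does not cover [F], the third of three factors would start inside [h]; the second
    would then prolong a completed factor within [h], against freshness. *)
Lemma fresh_score_cat F h u : fresh F h -> ({subset F <= u} -> u = [::]) ->
  score F (h ++ u) <= 2.
Proof.
move=> Fh Fu; apply: score_le2 => p x1 x2 x3 wE [n1 n2 n3] [o1 o2 o3].
have Fx3 : {subset F <= x3} by apply/subset_occ; rewrite o3.
have wE' : h ++ u = (p ++ x1 ++ x2) ++ x3 by rewrite wE -!catA.
have [[e [hE x3E]]|[e [_ uE]]] := cat_eq_cat wE'; last first.
  have u0 : u = [::] by apply: Fu => y /Fx3; rewrite uE mem_cat orbC => ->.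
  by move: uE; rewrite u0; case: (e) => [|//] /= x30; rewrite -x30 in n3.
have := Fh p x1 (x2 ++ e); rewrite hE -!catA => /(_ erefl o1).
suff H : {subset x2 ++ e <= F}.
  by move=> /(_ H); case: (x2) n2.
move=> y; rewrite mem_cat => /orP[|ye]; first by rewrite -o2 inE.
by rewrite -o3 inE x3E mem_cat ye.
Qed.

(* In three consecutive factors with occurrence set [F], the third starts at or
   before [b] and contains it, so the second, which contains [b] too, starts
   within [h]. *)
Lemma fresh_score_once F h t b r : fresh F h -> b \notin t ->
  ({subset F <= r} -> r = [::]) -> score F (h ++ t ++ b :: r) <= 2.
Proof.
move=> Fh bt Fr; apply: score_le2 => p x1 x2 x3 wE [n1 n2 n3] [o1 o2 o3].
have Fx3 : {subset F <= x3} by apply/subset_occ; rewrite o3.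
have wE' : rcons (h ++ t) b ++ r = (p ++ x1 ++ x2) ++ x3.
  by rewrite cat_rcons -!catA.
have [[e [hE x3E]]|[e [_ rE]]] := cat_eq_cat wE'; last first.
  have r0 : r = [::] by apply: Fr => y /Fx3; rewrite rE mem_cat orbC => ->.
  by move: rE; rewrite r0; case: (e) => [|//] /= x30; rewrite -x30 in n3.
case/lastP: e => [|e b'] in hE x3E.
  by move: n3; rewrite x3E /= Fr // => y /Fx3; rewrite x3E.
move: hE; rewrite -rcons_cat => /rcons_inj [hE bE]; rewrite -bE in x3E.
have bx2 : b \in x2.
  by have : b \in F; [rewrite -o3 inE x3E mem_cat mem_rcons mem_head | rewrite -o2 inE].
have hE' : h ++ t = (p ++ x1) ++ (x2 ++ e) by rewrite hE -!catA.
have [[e1 [hE1 x2E]]|[e1 [_ tE]]] := cat_eq_cat hE'; last first.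
  by move: bt; rewrite tE !mem_cat bx2 !orbT.
have e1_0 : e1 = [::].
  apply: (Fh p x1 e1) => //; first by rewrite hE1 -!catA.
  move=> y ye1; have : y \in x2 ++ e by rewrite x2E mem_cat ye1.
  rewrite mem_cat => /orP[|ye]; first by rewrite -o2 inE.
  by rewrite -o3 inE x3E mem_cat mem_rcons inE ye orbT.
by move: bt; rewrite -[t]/([::] ++ t) -e1_0 -x2E mem_cat bx2.
Qed.

(** Suffixes of one word are nested, so a set containing the longest one that fits in a member of
    [Fs] contains them all. *)
Lemma ex_longest_suffix (Fs : {set {set V}}) F0 h : F0 \in Fs ->
  exists2 C, C \in Fs & forall F p q, F \in Fs -> h = p ++ q ->
    {subset q <= F} -> {subset q <= C}.
Proof.
move=> F0s; elim: h => [|v h [C Cs HC]].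
  by exists F0 => // F [|? ?] [|? ?].
have [[F Fs_F sub_F]|no_F] := pselect (exists2 F, F \in Fs & {subset v :: h <= F}).
  by exists F => // F' p q _ hE _ y yq; apply: sub_F; rewrite hE mem_cat yq orbT.
exists C => // F [|v' p] q Fs_F /= hE sub_q.
  by case: no_F; exists F => //; rewrite hE.
by case: hE => _ hE; apply: HC Fs_F hE sub_q.
Qed.

End Words.

(** * Attractors *)

Section Attractor.
Variables (V : finType) (G : muller_game V).
Implicit Types (i : bool) (X T : {set V}) (Q : V -> Prop).

(** The controllable predecessor of [Q] in the subgame on [X]. *)
Definition can_move i X s Q : Prop :=
  if s \in pos G i then exists t, [/\ t \in X, edge G s t & Q t]
  else forall t, t \in X -> edge G s t -> Q t.

Lemma can_moveW i X s Q Q' : (forall t, t \in X -> edge G s t -> Q t -> Q' t) ->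
  can_move i X s Q -> can_move i X s Q'.
Proof.
rewrite /can_move => QQ'; case: ifP => _.
  by case=> t [tX st Qt]; exists t; split; auto.
by move=> H t tX st; auto.
Qed.

Lemma not_can_move i X s Q :
  ~ can_move i X s Q -> can_move (~~ i) X s (fun t => ~ Q t).
Proof.
rewrite /can_move in_posN; case: ifP => _ /= H.
  by move=> t tX st Qt; apply: H; exists t.
apply: contrapT => H'; apply: H => t tX st.
by apply: contrapT => nQ; apply: H'; exists t.
Qed.

Definition subarena X := forall s, s \in X -> exists2 t, t \in X & edge G s t.

Section AttrFixpoint.
Variables (i : bool) (X T : {set V}).

Definition attr_step (S : {set V}) :=
  T :|: [set s in X | `[< can_move i X s (fun t => t \in S) >]].

Definition attr := fixset attr_step.

(** The value outside the attractor exceeds every rank inside, so entering the attractor counts as a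
    descent. *)
Definition attr_rank s :=
  if s \in attr then fix_order attr_step s else #|V|.+1.

Lemma attr_step_mono : {homo attr_step : S S' / S \subset S'}.
Proof.
move=> S S' /subsetP SS'; apply: setUS; apply/subsetP => s; rewrite !inE.
by case: (s \in X) => //= /asboolP H; apply/asboolP; apply: can_moveW H => t _ _ /SS'.
Qed.

Lemma attrE : attr = attr_step attr.
Proof. by rewrite /attr (fixsetK attr_step_mono). Qed.

Lemma sub_attr : T \subset attr.
Proof. by rewrite attrE subsetUl. Qed.

Lemma attr_sub : T \subset X -> attr \subset X.
Proof.
by move=> TX; rewrite attrE subUset TX; apply/subsetP => s; rewrite inE => /andP[].
Qed.

Lemma attr_rank_le s : s \in attr -> attr_rank s <= #|V|.
Proof.
by move=> sA; rewrite /attr_rank sA fix_order_le_max.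
Qed.

Lemma attr_rank_notin s : s \notin attr -> attr_rank s = #|V|.+1.
Proof. by move=> sA; rewrite /attr_rank (negPf sA). Qed.

Lemma attr_rank_lt s t : s \notin attr -> t \in attr -> attr_rank t < attr_rank s.
Proof. by move=> /attr_rank_notin -> /attr_rank_le; rewrite ltnS. Qed.

Lemma attr_move s : s \in attr -> s \notin T ->
  can_move i X s (fun t => t \in attr /\ attr_rank t < attr_rank s).
Proof.
move=> sA sT; rewrite {2}/attr_rank sA.
have : 0 < fix_order attr_step s by rewrite fix_order_gt0.
have : s \in iter (fix_order attr_step s) attr_step set0.
  by rewrite in_iter_fix_orderE.
(* [s] first appears at stage [k.+1] of the iteration, so the move reaches stage [k]. *)
case: (fix_order _ s) => // k /=; rewrite !inE (negPf sT) /=.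
move=> /andP[_ /asboolP H] _; apply: can_moveW H => t _ _ tk.
have tA : t \in attr by apply: subsetP tk; apply: (iter_sub_fix attr_step_mono).
split=> //; rewrite /attr_rank tA ltnS.
exact: (fix_order_small attr_step_mono tk).
Qed.

Lemma attr_trap s : s \in X -> s \notin attr ->
  can_move (~~ i) X s (fun t => t \notin attr).
Proof.
move=> sX sA; apply: can_moveW (_ : can_move _ _ _ (fun t => ~ t \in attr)).
  by move=> t _ _ /negP.
apply: not_can_move => H; move: sA; rewrite attrE !inE sX /=.
by rewrite (introT (asboolP _) H) orbT.
Qed.

Lemma subarena_attrC : subarena X -> subarena (X :\: attr).
Proof.
move=> subX s; rewrite inE => /andP[sA sX].
have [t tX st] := subX s sX.
have := attr_trap sX sA; rewrite /can_move; case: ifP => _.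
  by case=> t' [tX' st' tA']; exists t'; rewrite // inE tA'.
by move=> H; exists t; rewrite // inE H.
Qed.

End AttrFixpoint.

(** The opponent cannot leave the complement of its own attractor, so passing from there to [X]
    gives it no new move. *)
Lemma can_move_attrC i X T Q s : s \in X :\: attr (~~ i) X T ->
  can_move i (X :\: attr (~~ i) X T) s Q -> can_move i X s Q.
Proof.
rewrite inE => /andP[sA sX]; have := attr_trap sX sA; rewrite negbK /can_move.
case: ifP => _ H; first by case=> t []; rewrite inE => /andP[_ tX]; exists t.
by move=> H' t tX st; apply: H'; rewrite // inE tX H.
Qed.

End Attractor.

(** * Regions with bounded scores *)

Section SafeRegions.
Variables (V : finType) (G : muller_game V).
Implicit Types (i : bool) (X W : {set V}).

Definition opp_sets i W := [set F in muller_family G (~~ i) | F \subset W].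

Lemma opp_setsS i W W' F : W' \subset W -> F \in opp_sets i W' -> F \in opp_sets i W.
Proof. by move=> W'W; rewrite !inE => /andP[-> /subset_trans->]. Qed.

Lemma opp_sets_restrict i W W' F :
  F \in opp_sets i W -> F \subset W' -> F \in opp_sets i W'.
Proof. by rewrite !inE => /andP[-> _]. Qed.

Definition bounded i W w := forall F, F \in opp_sets i W -> score F w <= 2.

Definition fresh_in i W h := forall F, F \in opp_sets i W -> fresh F h.

Lemma fresh_inS i W W' h : W' \subset W -> fresh_in i W h -> fresh_in i W' h.
Proof. by move=> W'W Wh F /(opp_setsS W'W) /Wh. Qed.

Lemma fresh_bounded i W h : fresh_in i W h -> bounded i W h.
Proof.
by move=> Wh F /Wh Fh; rewrite -[h]cats0; apply: fresh_score_cat.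
Qed.

Definition invariant i X W (P : seq V -> V -> Prop) := forall w s, P w s ->
  [/\ s \in W, bounded i W (rcons w s) & can_move G i X s (P (rcons w s))].

(** A greatest fixed point, encoded as the union of all invariants: safety is proved by exhibiting
    an invariant, without handling strategies. *)
Definition safe i X W w s := exists2 P, invariant i X W P & P w s.

Lemma safe_invariant i X W : invariant i X W (safe i X W).
Proof.
move=> w s [P invP Pws]; have [sW bnd mv] := invP _ _ Pws; split=> //.
by apply: can_moveW mv => t _ _ Pt; exists P.
Qed.

Lemma safe_in i X W w s : safe i X W w s -> s \in W.
Proof. by case/safe_invariant. Qed.

Definition safe_region i X W := W \subset X /\
  forall w s, s \in W -> fresh_in i W (rcons w s) -> safe i X W w s.

Lemma safe_region0 i X : safe_region i X set0.
Proof. by split=> [|w s]; rewrite ?sub0set ?inE. Qed.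

Lemma safe_region_attrC i X T W :
  safe_region i (X :\: attr G (~~ i) X T) W -> safe_region i X W.
Proof.
case=> WX' safeW; have WX := subset_trans WX' (subsetDl _ _); split=> //.
move=> w s sW Wws; exists (safe i (X :\: attr G (~~ i) X T) W); last exact: safeW.
move=> w' s' /safe_invariant [s'W bnd mv]; split=> //.
by apply: can_move_attrC mv; apply: (subsetP WX').
Qed.

(** * Extending a safe region by an attractor *)

Section RegionAttr.
Variables (i : bool) (X B D : {set V}).
Local Notation A := (attr G i X B).
Local Notation rk := (attr_rank G i X B).
Hypotheses (safeB : safe_region i X B) (safeD : safe_region i (X :\: A) D).

(* [h] is the history at which the play started: first inside [D], then descending
   in the attractor, and finally inside [B]. *)
Definition attr_phase w s := exists h u,
  [/\ rcons w s = h ++ u, fresh_in i (A :|: D) h &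
  [\/ {subset u <= D} /\ safe i (X :\: A) D w s,
      [/\ s \in A, s \notin B, {in u, forall v, rk s <= rk v}
        & bounded i (A :|: D) (rcons w s)]
    | safe i X B w s /\ ({subset u <= B} \/ exists t b r,
        [/\ u = t ++ b :: r, b \notin t & {subset r <= B}])]].

(** The descent in rank makes [t] new since [h], so [fresh_score_once] applies. On arrival in [B],
    the preceding vertex lies outside [B], so the history is fresh for all sets inside [B]. *)
Lemma attr_phase_enter w s t h u : rcons w s = h ++ u ->
  fresh_in i (A :|: D) h -> s \notin B -> t \in A ->
  {in u, forall v, rk t < rk v} -> attr_phase (rcons w s) t.
Proof.
move=> wE Wh sB tA lt_t; exists h, (rcons u t).
have tu : t \notin u by apply/negP => /lt_t; rewrite ltnn.
have wE' : rcons (rcons w s) t = h ++ rcons u t by rewrite wE rcons_cat.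
split=> //; have [tB|tB] := boolP (t \in B); [apply: Or33|apply: Or32].
  split; last by right; exists u, t, [::]; rewrite cats1.
  have [_] := safeB; apply=> // F; rewrite inE => /andP[_ /subsetP FB].
  apply: fresh_rcons => w' s' /rcons_inj[_ <-].
  by apply: contra sB => /FB.
split=> // [v|F WF].
  by rewrite mem_rcons inE => /orP[/eqP->|/lt_t/ltnW].
by rewrite wE' -cats1; apply: fresh_score_once => //; apply: Wh.
Qed.

(** The opponent can leave [D] only into the attractor, where descending ranks lead to [B]; the play
    then stays in [B]. *)
Lemma safe_region_attr : safe_region i X (A :|: D).
Proof.
have [BX safeB'] := safeB; have [DX safeD'] := safeD.
have BA : B \subset A := sub_attr G i X B.
have DA v : v \in D -> v \notin A by move/(subsetP DX); rewrite inE => /andP[].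
split.
  by rewrite subUset attr_sub //= (subset_trans DX) // subsetDl.
move=> w s sW Wws; exists attr_phase => [{}w {}s {sW Wws}|]; last first.
  exists (rcons w s), [::]; rewrite cats0; split=> //.
  move: sW; rewrite inE => /orP[sA|sD]; last first.
    by constructor 1; split=> //; apply: safeD' => //; apply: fresh_inS Wws; apply: subsetUr.
  have [sB|sB] := boolP (s \in B).
    constructor 3; split; last by left.
    apply: safeB' => //; apply: fresh_inS Wws.
    exact: subset_trans BA (subsetUl _ _).
  by constructor 2; split=> //; apply: fresh_bounded.
case=> h [u [wE Wh]] [[uD /[dup] safe_s /safe_invariant[sD bnd mv]]
  |[sA sB le_s bnd]|[/[dup] safe_s /safe_invariant[sB bnd mv] uE]].
- split; first by rewrite inE sD orbT.
    move=> F WF; have [FD|/negP FD] := boolP (F \subset D).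
      exact: bnd (opp_sets_restrict WF FD).
    (* A set not inside [D] is never covered by a stretch spent in [D]. *)
    rewrite wE; apply: fresh_score_cat (Wh _ WF) _ => Fu; case: FD.
    by apply/subsetP => v /Fu /uD.
  have next t : safe i (X :\: A) D (rcons w s) t -> attr_phase (rcons w s) t.
    move=> safe_t; exists h, (rcons u t); split=> //; first by rewrite wE rcons_cat.
    constructor 1; split=> // v; rewrite mem_rcons inE => /orP[/eqP->|/uD //].
    exact: safe_in safe_t.
  move: mv; rewrite /can_move; case: ifP => _.
    by case=> t [tX st safe_t]; exists t; split; [case/setDP: tX| |apply: next].
  move=> mv t tX st; have [tA|tA] := boolP (t \in A).
    apply: (attr_phase_enter wE) => // [|v /uD /DA vA].
      by apply: contra (DA _ sD) => /(subsetP BA).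
    exact: attr_rank_lt.
  by apply: next; apply: mv; rewrite // inE tA.
- split=> //; first by rewrite inE sA.
  apply: can_moveW (attr_move sA sB) => t _ _ [tA lt_t].
  apply: (attr_phase_enter wE) => // v /le_s; exact: leq_trans.
- split; first by rewrite inE (subsetP BA).
    move=> F WF; have [FB|/negP FB] := boolP (F \subset B).
      exact: bnd (opp_sets_restrict WF FB).
    have notFB r : {subset r <= B} -> {subset F <= r} -> r = [::].
      by move=> rB Fr; case: FB; apply/subsetP => v /Fr /rB.
    rewrite wE; case: uE => [uB|[t [b [r [-> bt rB]]]]].
      by apply: fresh_score_cat (Wh _ WF) _; apply: notFB.
    by apply: fresh_score_once (Wh _ WF) bt _; apply: notFB.
  apply: can_moveW mv => t _ _ safe_t.
  exists h, (rcons u t); split=> //; first by rewrite wE rcons_cat.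
  have tB := safe_in safe_t.
  have sub_rcons r : {subset r <= B} -> {subset rcons r t <= B}.
    by move=> rB v; rewrite mem_rcons inE => /orP[/eqP->|/rB].
  constructor 3; split=> //; case: uE => [uB|[t' [b [r [-> bt rB]]]]].
    by left; apply: sub_rcons.
  by right; exists t', b, (rcons r t); rewrite rcons_cat; split=> //; apply: sub_rcons.
Qed.

End RegionAttr.

(** * Safety of a whole subarena by repeated rounds *)

Section RegionCycle.
Variables (i : bool) (X : {set V}).
Local Notation A C := (attr G i X (X :\: C)).
Local Notation rk C := (attr_rank G i X (X :\: C)).
Local Notation Y C := (X :\: A C).
Hypotheses (subX : subarena G X).
Hypothesis safeY : forall C, C \in opp_sets i X -> safe_region i (Y C) (Y C).

Definition longest_in (C : {set V}) h := forall F p q, F \in opp_sets i X -> h = p ++ q ->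
  {subset q <= F} -> {subset q <= C}.

(* [h] is the history at which [C] was chosen. *)
Definition cycle_phase w s := exists C h u,
  [/\ C \in opp_sets i X, longest_in C h /\ fresh_in i X h, rcons w s = h ++ u,
      {subset u <= C} &
      {subset u <= Y C} /\ safe i (Y C) (Y C) w s \/
      [/\ s \in A C, s \in C, {in u, forall v, rk C s <= rk C v}
        & bounded i X (rcons w s)]].

Definition cycle_invariant w s :=
  s \in X /\ (fresh_in i X (rcons w s) \/ cycle_phase w s).

Lemma YC_sub C : Y C \subset C.
Proof.
apply/subsetP => v /setDP[vX]; apply: contraR => vC.
by apply: (subsetP (sub_attr _ _ _ _)); rewrite inE vC.
Qed.

Lemma fresh_cycle_phase w s : s \in X -> fresh_in i X (rcons w s) ->
  cycle_phase w s \/ {in opp_sets i X, forall F : {set V}, s \notin F}.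
Proof.
move=> sX Wws.
have [[F0 XF0 sF0]|no_F] := pselect (exists2 F, F \in opp_sets i X & s \in F);
  last by right=> F XF; apply/negP => sF; apply: no_F; exists F.
have [C XC HC] := ex_longest_suffix (rcons w s) XF0.
left; exists C, (rcons w s), [::]; rewrite cats0; split=> //.
(* The last vertex alone is a suffix of the history that fits in [F0]. *)
have sC : s \in C.
  apply: (HC F0 w [:: s]); rewrite ?cats1 ?mem_head // => v.
  by rewrite inE => /eqP->.
have [sA|sA] := boolP (s \in A C).
  by right; split=> //; apply: fresh_bounded.
have [_ safeC] := safeY XC; left; split=> //; apply: safeC; first by rewrite inE sA.
by apply: fresh_inS Wws; apply: subsetDl.
Qed.

(** By the descent in rank, [t] is new since [h]. Inside [C] the round goes on; outside, the choice
    of [C] makes the history fresh and the round ends. *)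
Lemma cycle_enter w s t C h u :
  C \in opp_sets i X -> longest_in C h -> fresh_in i X h -> rcons w s = h ++ u ->
  {subset u <= C} -> t \in X -> t \in A C -> {in u, forall v, rk C t < rk C v} ->
  cycle_invariant (rcons w s) t.
Proof.
move=> XC HC Wh wE uC tX tA lt_t; split=> //.
have tu : t \notin u by apply/negP => /lt_t; rewrite ltnn.
have [tC|tC] := boolP (t \in C); [right|left].
  exists C, h, (rcons u t); rewrite wE rcons_cat; split=> // [v|].
    by rewrite mem_rcons inE => /orP[/eqP->|/uC].
  right; split=> // [v|F XF].
    by rewrite mem_rcons inE => /orP[/eqP->|/lt_t/ltnW].
  by rewrite -cats1; apply: fresh_score_once => //; apply: Wh.
rewrite wE => F XF; apply: fresh_cat_rcons => // p q hE /(HC _ _ _ XF hE) qC.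
by apply: contra tC => /qC.
Qed.

Lemma cycle_phase_move w s : cycle_phase w s ->
  bounded i X (rcons w s) /\ can_move G i X s (cycle_invariant (rcons w s)).
Proof.
case=> C [h [u [XC [HC Wh] wE uC]]].
case=> [[uY /[dup] safe_s /safe_invariant[sY bnd mv]]|[sA sC le_s bnd]]; last first.
  split=> //; have sT : s \notin X :\: C by rewrite inE sC.
  apply: can_moveW (attr_move sA sT) => t tX _ [tA lt_t].
  apply: (cycle_enter XC HC Wh wE) => // v /le_s; exact: leq_trans.
split=> [F XF|].
  have [FY|/negP FY] := boolP (F \subset Y C).
    exact: bnd (opp_sets_restrict XF FY).
  rewrite wE; apply: fresh_score_cat (Wh _ XF) _ => Fu; case: FY.
  by apply/subsetP => v /Fu /uY.
have next t : safe i (Y C) (Y C) (rcons w s) t -> cycle_invariant (rcons w s) t.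
  move=> safe_t; have tY := safe_in safe_t.
  have sub_rcons (B : {set V}) : t \in B -> {subset u <= B} -> {subset rcons u t <= B}.
    by move=> tB uB v; rewrite mem_rcons inE => /orP[/eqP->|/uB].
  split; first by case/setDP: tY.
  right; exists C, h, (rcons u t); rewrite wE rcons_cat; split=> //.
    exact: sub_rcons (subsetP (YC_sub C) _ tY) uC.
  by left; split; [apply: sub_rcons|rewrite -wE].
move: mv; rewrite /can_move; case: ifP => _.
  by case=> t [/setDP[tX _] st /next]; exists t.
move=> mv t tX st; have [tA|tA] := boolP (t \in A C).
  apply: (cycle_enter XC HC Wh wE) => // v /uY /setDP[_ vA].
  exact: attr_rank_lt.
by apply: next; apply: mv; rewrite // inE tA.
Qed.

Lemma safe_region_cycle : safe_region i X X.
Proof.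
split=> // w s sX Wws; exists cycle_invariant; last by split=> //; left.
move=> {}w {}s {sX Wws} [sX ph]; split=> //.
  by case: ph => [/fresh_bounded //|/cycle_phase_move[]].
case: ph => [/(fresh_cycle_phase sX)[/cycle_phase_move[]//|sF]|/cycle_phase_move[]//].
(* As [s] lies in no opponent set, every move leads to a fresh history. *)
have next t : t \in X -> cycle_invariant (rcons w s) t.
  move=> tX; split=> //; left=> F /sF sF'.
  by apply: fresh_rcons => w' s' /rcons_inj[_ <-].
rewrite /can_move; case: ifP => _; last by move=> t tX _; apply: next.
by have [t tX st] := subX sX; exists t; split=> //; apply: next.
Qed.

End RegionCycle.

Lemma determinacy X : subarena G X -> exists W : bool -> {set V},
  (forall v, v \in X -> exists i, v \in W i) /\ forall i, safe_region i X (W i).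
Proof.
have [n] := ubnP #|X|; elim: n X => // n IH X lt_Xn subX.
have [U I] := family_bipartition G.
have [i XFi] : exists i, X \in muller_family G i.
  have : X \in family0 G :|: family1 G by rewrite U inE.
  by rewrite inE => /orP[]; [exists false|exists true].
have XFNi : X \notin muller_family G (~~ i).
  have : X \notin family0 G :&: family1 G by rewrite I inE.
  by move: XFi; rewrite inE /muller_family; case: (i) => /= ->; rewrite ?andbT.
have IHattr j (T : {set V}) : T != set0 -> T \subset X ->
    exists W : bool -> {set V}, (forall v, v \in X :\: attr G j X T -> exists i, v \in W i)
    /\ forall i, safe_region i (X :\: attr G j X T) (W i).
  move=> /set0Pn[v vT] TX; apply: IH; last exact: subarena_attrC.
  have vA := subsetP (sub_attr G j X T) v vT.
  rewrite -ltnS; apply: leq_trans lt_Xn; rewrite ltnS; apply: proper_card.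
  by rewrite properE subsetDl; apply/subsetPn; exists v; rewrite ?(subsetP TX) // inE vA.
(* This makes the attractor nonempty, so that its complement is smaller than [X]. *)
have opp_proper C : C \in opp_sets i X -> X :\: C != set0.
  rewrite inE => /andP[CF CX]; apply: contraNneq XFNi => /eqP.
  by rewrite setD_eq0 => XC; have <- : C = X by apply/eqP; rewrite eqEsubset CX.
have [[C XC [B B0 safeB]]|no_B] := pselect (exists2 C, C \in opp_sets i X &
    exists2 B, B != set0 & safe_region (~~ i) (X :\: attr G i X (X :\: C)) B).
  have safeB' : safe_region (~~ i) X B.
    by apply: (@safe_region_attrC (~~ i) X (X :\: C)); rewrite negbK.
  have [W [coverW safeW]] := IHattr (~~ i) B B0 (proj1 safeB').
  exists (fun k => if k == i then W i else attr G (~~ i) X B :|: W (~~ i)); split.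
    move=> v vX; have [vA|vA] := boolP (v \in attr G (~~ i) X B).
      by exists (~~ i); rewrite ifN ?inE ?vA //; case: (i).
    have [|k vk] := coverW v; first by rewrite inE vA.
    exists k; case: eqVneq => [<- //|ki]; rewrite inE.
    by have -> : ~~ i = k; [case: (i) (k) ki => [] []|rewrite vk orbT].
  move=> k; case: eqVneq => [->|ki]; first exact: safe_region_attrC (safeW i).
  have -> : k = ~~ i by case: (i) (k) ki => [] [].
  exact: safe_region_attr safeB' (safeW (~~ i)).
exists (fun k => if k == i then X else set0); split=> [v vX|k].
  by exists i; rewrite eqxx.
case: eqVneq => [->|_]; last exact: safe_region0.
apply: safe_region_cycle => // C XC.
have [W [coverW safeW]] := IHattr i _ (opp_proper C XC) (subsetDl _ _).
(* With the opponent's region empty, the cover leaves all of the complement to Player [i]. *)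
have W0 : W (~~ i) = set0.
  apply/eqP; apply: contrapT => /negP W0; apply: no_B; exists C => //.
  by exists (W (~~ i)).
suff {2}-> : X :\: attr G i X (X :\: C) = W i by exact: safeW.
apply/eqP; rewrite eqEsubset (proj1 (safeW i)) andbT; apply/subsetP => v vY.
have [j vj] := coverW v vY; have [<- //|ji] := eqVneq j i.
have jE : j = ~~ i by case: (i) (j) ji => [] [].
by move: vj; rewrite jE W0 inE.
Qed.

End SafeRegions.

(** * From bounded scores to winning strategies *)

Section InfiniteVisits.
Variables (V : finType) (rho : nat -> V).
Local Notation seg n l := [seq rho k | k <- iota n l].

Lemma inf_set_eventually : exists N, forall n, N <= n -> rho n \in inf_set rho.
Proof.
have H v : exists N, v \notin inf_set rho -> forall n, N <= n -> rho n <> v.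
  have [|] := boolP (v \in inf_set rho); first by exists 0.
  rewrite inE => /asboolP /existsNP[N HN]; exists N => _ n le_n rn.
  by apply: HN; exists n.
have [f Hf] := choice H; exists (\max_v f v) => n le_n; apply/negPn/negP => rn.
by apply: (Hf _ rn n) => //; apply: leq_trans le_n; apply: leq_bigmax.
Qed.

Lemma inf_set_segment N n : (forall n, N <= n -> rho n \in inf_set rho) ->
  N <= n -> exists l, occ (seg n l.+1) = inf_set rho.
Proof.
move=> HN le_n.
have H v : exists m, v \in inf_set rho -> n <= m /\ rho m = v.
  have [|_] := boolP (v \in inf_set rho); last by exists 0.
  by rewrite inE => /asboolP /(_ n) [m]; exists m.
have [f Hf] := choice H; exists (\max_v f v); apply/setP => v; rewrite inE.
apply/mapP/idP => [[k]|/Hf[le_m <-]].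
  by rewrite mem_iota => /andP[/(leq_trans le_n) /HN + _] ->.
exists (f v) => //; rewrite mem_iota le_m ltn_addl // ltnS.
exact: leq_bigmax.
Qed.

(** Eventually only vertices of [inf_set rho] occur, and each keeps returning, so three consecutive
    segments with exactly this occurrence set can be cut out. *)
Lemma score_inf_set : exists n, 2 < score (inf_set rho) (mkseq rho n.+1).
Proof.
have [N HN] := inf_set_eventually.
have [l1 o1] := inf_set_segment HN (leqnn N).
have [l2 o2] := inf_set_segment HN (leq_addr l1.+1 N).
have [l3 o3] := inf_set_segment HN (leq_trans (leq_addr l1.+1 N) (leq_addr l2.+1 _)).
exists (N + l1.+1 + l2.+1 + l3); apply: score_max.
exists [:: seg N l1.+1; seg (N + l1.+1) l2.+1; seg (N + l1.+1 + l2.+1) l3.+1].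
split=> // [x|].
  by rewrite !inE => /or3P[]/eqP->.
apply/suffixP; exists (seg 0 N).
by rewrite /mkseq -addnS !iotaD !map_cat add0n /= cats0 -!catA.
Qed.

End InfiniteVisits.

(** * Strategies from safe regions *)

Section SafeStrategy.
Variables (V : finType) (G : muller_game V) (i : bool) (W : {set V}).
Hypothesis safeW : safe_region G i [set: V] W.

Lemma ex_safe_strategy : exists sigma : strategy G i,
  forall rho, is_play G rho -> rho 0 \in W -> consistent sigma rho ->
  score_ub (muller_family G (~~ i)) rho 2.
Proof.
(* The move stays safe whenever some successor does, and is an arbitrary edge otherwise. *)
have H (ws : seq V * V) : exists t, edge G ws.2 t /\
    (forall t', edge G ws.2 t' /\ safe G i [set: V] W (rcons ws.1 ws.2) t' ->
     safe G i [set: V] W (rcons ws.1 ws.2) t).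
  have [[t [st safe_t]]|no] := pselect (exists t', edge G ws.2 t' /\
      safe G i [set: V] W (rcons ws.1 ws.2) t').
    by exists t.
  have [t st] := edge_total G ws.2; exists t; split=> // t' safe_t'.
  by case: no; exists t'.
have [f Hf] := choice H.
have fe w s : s \in pos G i -> edge G s (f (w, s)) by move=> _; have [] := Hf (w, s).
exists (Strategy fe) => rho play_rho rho0 cons_rho.
have safe_rho n : safe G i [set: V] W (mkseq rho n) (rho n).
  elim: n => [|n /safe_invariant[_ _]].
    by apply: (proj2 safeW) => // F _; apply: fresh_rcons => -[].
  rewrite /can_move mkseqS; case: ifP => si mv; last first.
    exact: mv (in_setT _) (play_rho n).
  rewrite cons_rho //; case: mv => t [_ st safe_t].
  by have [_] := Hf (mkseq rho n, rho n); apply; split; eassumption.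
move=> F oppF n; have [FW|/negP FW] := boolP (F \subset W).
  have [_ bnd _] := safe_invariant (safe_rho n).
  by rewrite mkseqS; apply: bnd; rewrite inE oppF.
have F0 : fresh F [::] by case=> [|? ?] [|? ?] [|? ?].
apply: (fresh_score_cat (u := mkseq rho n.+1) F0) => Fu; case: FW.
by apply/subsetP => v /Fu /mapP[k _ ->]; apply: safe_in (safe_rho k).
Qed.

Lemma score_ub_wins rho : score_ub (muller_family G (~~ i)) rho 2 -> wins G i rho.
Proof.
move=> ub; rewrite /wins; have [n] := score_inf_set rho.
have [U _] := family_bipartition G.
have : inf_set rho \in family0 G :|: family1 G by rewrite U inE.
rewrite ltnNge inE => cover; apply: contraNT => Ni; apply: ub.
by move: cover Ni; rewrite /muller_family; case: (i) => /= /orP[] -> //.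
Qed.

End SafeStrategy.

Theorem lemma15 (V : finType) (G : muller_game V) (i : bool) :
  exists sigma : strategy G i,
    winning sigma (win_region G i) /\
    forall v : V, v \in win_region G i ->
    forall tau : strategy G (~~ i),
      le_enat (maxsc (muller_family G (~~ i)) (play v sigma tau)) (Some 2).
Proof.
have subT : subarena G [set: V].
  by move=> s _; have [t st] := edge_total G s; exists t; rewrite ?inE.
have [W [coverW safeW]] := determinacy subT.
have [sigma ub_sigma] := ex_safe_strategy (safeW i).
have [tau ub_tau] := ex_safe_strategy (safeW (~~ i)).
(* Otherwise [v] lies in the opponent's safe region, and the winning strategy played against [tau]
   yields a play won by both players. *)
have winW v : v \in win_region G i -> v \in W i.
  rewrite inE => /asboolP[sigma' win_sigma'].
  have [k vk] := coverW v (in_setT v); have [<- //|ki] := eqVneq k i.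
  have kE : k = ~~ i by case: (i) (k) ki => [] [].
  have [pl pl0 cs ct] := play_spec v sigma' tau.
  have win_i : wins G i (play v sigma' tau) by apply: win_sigma'; rewrite ?pl0 ?inE.
  have win_Ni : wins G (~~ i) (play v sigma' tau).
    by apply/score_ub_wins/ub_tau; rewrite // pl0 -kE.
  have [_ I] := family_bipartition G.
  have : inf_set (play v sigma' tau) \in family0 G :&: family1 G.
    move: win_i win_Ni; rewrite /wins /muller_family; move: (inf_set _) => F.
    by rewrite inE; case: (i) => /= -> ->.
  by rewrite I inE.
exists sigma; split=> [rho pl /winW rho0 cs|v /winW vW tau'].
  by apply/score_ub_wins/ub_sigma.
have [pl pl0 cs _] := play_spec v sigma tau'.
by apply/maxsc_le/ub_sigma; rewrite ?pl0.
Qed.
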